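(* Let $n\ge1$ be an integer and, for $f\in C(\Delta)$, define $$\mathcal L_n^*f(\mathbf t)=\sum_{\mathbf j\in\Lambda_n}f(\tfrac{\mathbf j}{n})\,\ell^\Delta_{\mathbf j,n}(\mathbf t),\qquad \ell^\Delta_{\mathbf j,n}(\mathbf t)=\lambda_{\mathbf j}^{(n)}\,\mathcal P^+\ell_{\mathbf j,n}(\mathbf t).$$ Then $\mathcal L_n^*f$ is the unique function in $\mathcal{TC}_n$ that satisfies $$\mathcal L_n^*f(\tfrac{\mathbf j}{n})=f(\tfrac{\mathbf j}{n}),\qquad\mathbf j\in\Lambda_n.$$ Furthermore, the fundamental interpolation function is given by $$\ell^\Delta_{\mathbf j,n}(\mathbf t)=\frac{\lambda_{\mathbf j}^{(n)}}{3n^2}\Big[\tfrac12\mathcal P^+\big(\Theta_n(\mathbf t-\tfrac{\mathbf j}{n})-\Theta_{n-2}(\mathbf t-\tfrac{\mathbf j}{n})\big)-\mathrm{Re}\big\{\mathsf{TC}_{n,0,-n}(\mathbf t)\,\overline{\mathsf{TC}_{n,0,-n}(\tfrac{\mathbf j}{n})}\big\}\Big],$$ where $\mathcal P^+$ acts on the variable $\mathbf t$.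
   Context: $\mathbb R^3_H=\{\mathbf t\in\mathbb R^3:t_1+t_2+t_3=0\}$, $\mathbb H=\mathbb Z^3\cap\mathbb R^3_H$, $\phi_{\mathbf k}(\mathbf t)=e^{\frac{2\pi i}{3}\mathbf k\cdot\mathbf t}$ for $\mathbf k\in\mathbb H$. The operator $\mathcal P^+$ acts on functions on $\mathbb R_H^3$ by $$\mathcal P^+f(t_1,t_2,t_3)=\tfrac16\big[f(t_1,t_2,t_3)+f(t_2,t_3,t_1)+f(t_3,t_1,t_2)+f(-t_1,-t_3,-t_2)+f(-t_2,-t_1,-t_3)+f(-t_3,-t_2,-t_1)\big],$$ and $\mathsf{TC}_{\mathbf k}=\mathcal P^+\phi_{\mathbf k}$. $\Delta=\{\mathbf t\in\mathbb R^3_H:0\le t_1,t_2,-t_3\le1\}$. $\Lambda_n=\{\mathbf k\in\mathbb H:k_1\ge0,k_2\ge0,-k_3\le n\}$, $\mathcal{TC}_n=\mathrm{span}_{\mathbb C}\{\mathsf{TC}_{\mathbf k}:\mathbf k\in\Lambda_n\}$. For $\mathbf j\in\Lambda_n$: $\lambda_{\mathbf j}^{(n)}=6$ if $j_1>0,j_2>0,-j_3<n$; $\lambda_{\mathbf j}^{(n)}=1$ if $\mathbf j\in\{(n,0,-n),(0,n,-n),(0,0,0)\}$; $\lambda_{\mathbf j}^{(n)}=3$ otherwise. Let $\mathbb H_n^*=\{\mathbf j\in\mathbb H:-n\le j_1,j_2,j_3\le n\}$ and $\mathbb H_n^\circ=\{\mathbf j\in\mathbb H:-n<j_1,j_2,j_3<n\}$;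 set $c_{\mathbf j}^{(n)}=1$ on $\mathbb H_n^\circ$, $c_{\mathbf j}^{(n)}=\frac12$ if $\mathbf j\in\mathbb H_n^*\setminus\mathbb H_n^\circ$ with $j_1j_2j_3\ne0$, $c_{\mathbf j}^{(n)}=\frac13$ if $\mathbf j\in\mathbb H_n^*\setminus\mathbb H_n^\circ$ with $j_1j_2j_3=0$. Then $\ell_{\mathbf j,n}(\mathbf t)=\Phi_n^*(\mathbf t-\frac{\mathbf j}{n})$ with $\Phi_n^*(\mathbf t)=\frac1{3n^2}\sum_{\mathbf k\in\mathbb H_n^*}c_{\mathbf k}^{(n)}\phi_{\mathbf k}(\mathbf t)$. Finally $$\Theta_n(\mathbf t)=\frac{\sin\frac{(n+1)\pi(t_1-t_2)}{3}\sin\frac{(n+1)\pi(t_2-t_3)}{3}\sin\frac{(n+1)\pi(t_3-t_1)}{3}}{\sin\frac{\pi(t_1-t_2)}{3}\sin\frac{\pi(t_2-t_3)}{3}\sin\frac{\pi(t_3-t_1)}{3}},$$ extended by continuity where the denominator vanishes. *)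

(* Defs.v *)
From HB Require Import structures.
From mathcomp Require Import all_boot all_order all_algebra.
From mathcomp Require Import complex.
From mathcomp Require Import all_classical all_reals all_analysis.

Set Implicit Arguments.
Unset Strict Implicit.
Unset Printing Implicit Defensive.

Import Order.TTheory GRing.Theory Num.Theory.
Import numFieldNormedType.Exports.

Local Open Scope classical_set_scope.
Local Open Scope complex_scope.
Local Open Scope ring_scope.

(* The homogeneous coordinates t_1, t_2, t_3 are t 0 0, t 0 1, t 0 2. *)

Definition vec3 (T : Type) (a b c : T) : 'rV[T]_3 :=
  \row_(i < 3) nth a [:: a; b; c] i.

(* For V = R this is the plane R^3_H, for V = int the lattice H. *)
Definition hplane (V : zmodType) : set 'rV[V]_3 :=
  [set t : 'rV[V]_3 | t 0 0 + t 0 1 + t 0 2 = 0].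

Definition Lambda (n : nat) : set 'rV[int]_3 :=
  [set k | [/\ hplane k, 0 <= k 0 0, 0 <= k 0 1 & - k 0 2 <= n%:Z]].

Definition Hstar (n : nat) : set 'rV[int]_3 :=
  [set j | hplane j /\ forall i : 'I_3, - n%:Z <= j 0 i <= n%:Z].

Definition Hopen (n : nat) : set 'rV[int]_3 :=
  [set j | hplane j /\ forall i : 'I_3, - n%:Z < j 0 i < n%:Z].

(* Only used for j in Lambda n. *)
Definition lambda (n : nat) (j : 'rV[int]_3) : nat :=
  if [&& 0 < j 0 0, 0 < j 0 1 & - j 0 2 < n%:Z] then 6%N
  else if j \in [:: vec3 n%:Z 0 (- n%:Z); vec3 0 n%:Z (- n%:Z); vec3 0 0 0]
  then 1%N
  else 3%N.

Section RealDefs.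
Variable R : realType.

Definition Delta : set 'rV[R]_3 :=
  [set t | [/\ hplane t, 0 <= t 0 0 <= 1, 0 <= t 0 1 <= 1 &
               0 <= - t 0 2 <= 1]].

(* The point j / n. *)
Definition node (n : nat) (j : 'rV[int]_3) : 'rV[R]_3 :=
  n%:R^-1 *: map_mx intr j.

(* exp (i x) *)
Definition expi (x : R) : R[i] := cos x +i* sin x.

Definition phi (k : 'rV[int]_3) (t : 'rV[R]_3) : R[i] :=
  expi (2 * pi / 3 * \sum_(i < 3) (k 0 i)%:~R * t 0 i).

(* Functions on R^3_H are represented by functions on R^3 of which only the
   values on the plane matter; Pplus only uses values on the plane when t lies
   in it. *)
Definition Pplus (f : 'rV[R]_3 -> R[i]) (t : 'rV[R]_3) : R[i] :=
  let t1 := t 0 0 in let t2 := t 0 1 in let t3 := t 0 2 in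
  6^-1 * (f (vec3 t1 t2 t3) + f (vec3 t2 t3 t1) + f (vec3 t3 t1 t2)
          + f (vec3 (- t1) (- t3) (- t2)) + f (vec3 (- t2) (- t1) (- t3))
          + f (vec3 (- t3) (- t2) (- t1))).

Definition TC (k : 'rV[int]_3) : 'rV[R]_3 -> R[i] := Pplus (phi k).

Definition TCspan (n : nat) : set ('rV[R]_3 -> R[i]) :=
  [set g | exists a : 'rV[int]_3 -> R[i], forall t : 'rV[R]_3, hplane t ->
     g t = \sum_(k \in Lambda n) a k * TC k t].

(* Only used for j in Hstar n. *)
Definition cweight (n : nat) (j : 'rV[int]_3) : R[i] :=
  if j \in Hopen n then 1
  else if j 0 0 * j 0 1 * j 0 2 != 0 then 2^-1 else 3^-1.

Definition Phistar (n : nat) (t : 'rV[R]_3) : R[i] :=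
  (3 * n%:R ^+ 2)^-1 * \sum_(k \in Hstar n) cweight n k * phi k t.

Definition ell (n : nat) (j : 'rV[int]_3) (t : 'rV[R]_3) : R[i] :=
  Phistar n (t - node n j).

Definition ellDelta (n : nat) (j : 'rV[int]_3) (t : 'rV[R]_3) : R[i] :=
  (lambda n j)%:R * Pplus (ell n j) t.

Definition Lstar (n : nat) (f : 'rV[R]_3 -> R[i]) (t : 'rV[R]_3) : R[i] :=
  \sum_(j \in Lambda n) f (node n j) * ellDelta n j t.

Definition Theta_num (m : int) (t : 'rV[R]_3) : R :=
  sin ((m + 1)%:~R * pi * (t 0 0 - t 0 1) / 3) *
  sin ((m + 1)%:~R * pi * (t 0 1 - t 0 2) / 3) *
  sin ((m + 1)%:~R * pi * (t 0 2 - t 0 0) / 3).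

Definition Theta_den (t : 'rV[R]_3) : R :=
  sin (pi * (t 0 0 - t 0 1) / 3) *
  sin (pi * (t 0 1 - t 0 2) / 3) *
  sin (pi * (t 0 2 - t 0 0) / 3).

(* The index is an integer because Theta (n - 2) occurs with n = 1. *)
Definition Theta (m : int) (t : 'rV[R]_3) : R :=
  let quot s := Theta_num m s / Theta_den s in
  if Theta_den t == 0
  then lim (quot s @[s --> within [set s | hplane s /\ Theta_den s != 0]
                                  (nbhs t)])
  else quot t.

End RealDefs.

(* Main.v *)
Require Import Defs.
From mathcomp Require Import all_boot all_order all_algebra.
From mathcomp Require Import complex finmap ring lra zify.
From mathcomp Require Import all_classical all_reals all_analysis.

(** Write A, B, C for the exponentials exp (2 pi i (t_j - t_{j+1}) / 3), whose
    product is 1 (edge1, edge2, edge3).  A frequency k in the lattice plane is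
    (a - c, b - a, c - b) for a triple of naturals that is unique up to adding
    (1,1,1), and then phi_k = A^a B^b C^c.  Two facts follow.

    First, since sin (p x) / sin x is a finite geometric sum, Theta_{p-1} is the
    sum of A^a B^b C^c over the cube 0 <= a, b, c < p (Theta_cubesum); the
    product formula extends continuously because the points of the plane where
    the denominator is nonzero are dense.

    Second, the triples with minimum 0 in the cube of side m run once through
    the frequencies of the closed hexagon of radius m, and the remaining ones
    are a translate by (1,1,1) of the smaller cube.  Hence the hexagonal
    Dirichlet kernel is Theta_m - Theta_{m-1} (hexagon_sum).  The weights c_j
    average the closed and the open hexagon, up to a correction at the six
    vertices, which gives Phi* as a combination of Theta_n - Theta_{n-2} and the
    vertex terms A^n + B^n + C^n and its conjugate (PhistarE).  Averaging over
    the six isometries turns the vertex terms into the real part of a product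
    of values of TC_{n,0,-n} (ellDelta_Theta).

    At a lattice node A^n = B^n = C^n is a cube root of unity, and evaluating
    the geometric sums shows that Phi* is 1 on the period lattice and 0 at the
    other nodes (Phistar_node).  The triangle is a fundamental domain of the
    group generated by the isometries and the period lattice, lambda being the
    orbit size, so the fundamental functions take the values delta_{jk} at the
    nodes (ellDelta_node).  This is interpolation.  Uniqueness is linear
    algebra: there are as many functions TC_k as nodes, and the fundamental
    functions give a right inverse of the square matrix of nodal values, which
    is then also a left inverse (TCspan_eq0). *)

Set Implicit Arguments.
Unset Strict Implicit.
Unset Printing Implicit Defensive.

Import Order.TTheory GRing.Theory Num.Theory.
Import numFieldNormedType.Exports.

Local Open Scope classical_set_scope.
Local Open Scope complex_scope.
Local Open Scope ring_scope.

(** * Unimodular exponentials and the ratio sin (p x) / sin x *)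

Section Exponential.
Variable R : realType.
Implicit Types x y : R.

Lemma expi0 : expi (0 : R) = 1.
Proof. by rewrite /expi cos0 sin0. Qed.

Lemma expiD x y : expi (x + y) = expi x * expi y.
Proof.
by apply/eqP; rewrite eq_complex /= cosD sinD eqxx /= addrC eqxx.
Qed.

Lemma expiN x : expi (- x) = (expi x)^*.
Proof. by rewrite /expi /= cosN sinN. Qed.

Lemma expiNM x : expi x * (expi x)^* = 1.
Proof. by rewrite -expiN -expiD subrr expi0. Qed.

Lemma expiMn x (n : nat) : expi (n%:R * x) = expi x ^+ n.
Proof.
elim: n => [|n IH]; first by rewrite mul0r expi0 expr0.
by rewrite -natr1 mulrDl mul1r expiD IH exprSr.
Qed.

Lemma expi_2pi : expi (2 * pi : R) = 1.
Proof. by rewrite mulr_natl /expi cos2pi sin2pi. Qed.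

Lemma expi_2piz (q : int) : expi (2 * pi * q%:~R : R) = 1.
Proof.
have H (m : nat) : expi (2 * pi * m%:R : R) = 1.
  by rewrite mulrC expiMn expi_2pi expr1n.
case: q => m; first exact: H.
by rewrite NegzE mulrNz mulrN expiN H; exact: conjc1.
Qed.

(** The half-angle has positive sine strictly inside a period, so the only
    rational multiples of a full turn with trivial exponential are whole. *)
Lemma expi_2piz_eq1 (q : int) (N : nat) : (0 < N)%N ->
  expi (2 * pi * (q%:~R / N%:R) : R) = 1 -> (N%:Z %| q)%Z.
Proof.
move=> N0 h; apply/dvdz_mod0P; apply: contrapT => r0.
have qE := divz_eq q N%:Z.
set r := (q %% N%:Z)%Z in r0 qE.
have NR : (0 : R) < N%:R by rewrite ltr0n.
have rge : 0 <= r by rewrite modz_ge0 //; lia.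
have rlt : r < N%:Z by rewrite ltz_mod //; lia.
clearbody r; have rgt : 0 < r by rewrite lt_neqAle eq_sym rge andbT; exact/eqP.
have e : expi (2 * pi * (r%:~R / N%:R) : R) = 1.
  rewrite -h -[LHS]mul1r -(expi_2piz (q %/ N%:Z)%Z) -expiD; congr expi.
  by rewrite [in RHS]qE intrD intrM -(pmulrn 1 N); field; rewrite gt_eqF.
have th : (0 : R) < @pi R * (r%:~R / N%:R) < @pi R.
  have u0 : (0 : R) < r%:~R / N%:R by rewrite divr_gt0 ?ltr0z.
  have u1 : r%:~R / N%:R < 1 :> R.
    by rewrite ltr_pdivrMr// mul1r (pmulrn 1 N) ltr_int.
  have p0 := pi_gt0 R.
  by apply/andP; split; nra.
have s0 := sin_gt0_pi th.
move: e; rewrite -mulrA mulr_natl /expi cos_mulr2n => /eqP.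
rewrite eq_complex /= => /andP[/eqP c1 _].
have := cos2Dsin2 (pi * (r%:~R / N%:R) : R).
move: c1 s0; set c := cos _; set s := sin _ => c1 s0 cs1.
by clear -c1 s0 cs1; nra.
Qed.
End Exponential.

Section DirichletRatio.
Variable R : realType.
Implicit Types x y z : R.

(** sin (p x) / sin x, written as a recursion so that it is also defined, and
    continuous, at the zeros of the sine. *)
Fixpoint sinratio (p : nat) x : R :=
  if p is p'.+1 then sinratio p' x * cos x + cos (p'%:R * x) else 0.

Lemma sinratioE p x : sinratio p x * sin x = sin (p%:R * x).
Proof.
elim: p => [|p IH] /=; first by rewrite !mul0r sin0.
by rewrite -natr1 [in RHS]mulrDl mul1r sinD -IH; ring.
Qed.

Lemma continuous_sinratio p : continuous (sinratio p).
Proof.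
elim: p => [|p IH] x /=; first exact: cvg_cst.
apply: cvgD; first by apply: cvgM; [exact: IH | exact: continuous_cos].
by apply: continuous_comp; [exact: mulrl_continuous | exact: continuous_cos].
Qed.

Definition gsum (p : nat) (w : R[i]) : R[i] := \sum_(a < p) w ^+ a.

(** Symmetrically centred, the geometric sum of exp (2 i x) is the real number
    sin (p x) / sin x; the identity is a phase-shifted form of this. *)
Lemma gsum_expi p x :
  expi x * gsum p (expi (2 * x)) = expi (p%:R * x) * (sinratio p x)%:C.
Proof.
elim: p => [|p IH]; first by rewrite /gsum big_ord0 mulr0 /= mulr0.
rewrite /gsum big_ord_recr /= -/(gsum _ _) mulrDr IH.
have key : (sinratio p x)%:C + expi (p%:R * x) * expi x
  = expi x * (sinratio p x * cos x + cos (p%:R * x))%:C.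
  have H := sinratioE p x; have H1 := cos2Dsin2 x.
  apply/eqP; rewrite eq_complex /= -H.
  apply/andP; split; apply/eqP; last by ring.
  transitivity (sinratio p x * (cos x ^+ 2 + sin x ^+ 2) +
    (cos (p%:R * x) * cos x - sinratio p x * sin x * sin x)); last by ring.
  by rewrite H1 mulr1.
have -> : p.+1%:R * x = p%:R * x + x by rewrite -(natr1 p); ring.
rewrite (expiD _ x) -[RHS]mulrA -key -expiMn.
rewrite (_ : p%:R * (2 * x) = p%:R * x + p%:R * x); last by ring.
by rewrite expiD; ring.
Qed.

(** The phases cancel as soon as the three angles add up to 0. *)
Lemma gsum_prod p x y z : x + y + z = 0 ->
  gsum p (expi (2 * x)) * gsum p (expi (2 * y)) * gsum p (expi (2 * z))
  = (sinratio p x * sinratio p y * sinratio p z)%:C.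
Proof.
move=> s.
have e1 : expi x * expi y * expi z = 1 by rewrite -!expiD s expi0.
have e2 : expi (p%:R * x) * expi (p%:R * y) * expi (p%:R * z) = 1.
  by rewrite -!expiD -!mulrDr s mulr0 expi0.
rewrite -[LHS]mul1r -{1}e1 !rmorphM /= -[RHS]mul1r -e2.
transitivity ((expi x * gsum p (expi (2 * x)))
  * (expi y * gsum p (expi (2 * y)))
  * (expi z * gsum p (expi (2 * z)))); first by ring.
by rewrite !gsum_expi; ring.
Qed.
End DirichletRatio.

(** * The kernel Theta as a sum over a cube *)

Section Coordinates.

Lemma vec3E (T : Type) (a b c : T) :
  ((vec3 a b c 0 0 = a) * (vec3 a b c 0 1 = b) * (vec3 a b c 0 2 = c))%type.
Proof. by rewrite !mxE. Qed.

Lemma vec3_eta (T : Type) (v : 'rV[T]_3) : v = vec3 (v 0 0) (v 0 1) (v 0 2).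
Proof.
apply/rowP => i; rewrite mxE; case: i => -[|[|[|//]]] ?;
  by rewrite /=; congr (v _ _); apply/val_inj.
Qed.

Lemma vec3P (T : Type) (u v : 'rV[T]_3) :
  u 0 0 = v 0 0 -> u 0 1 = v 0 1 -> u 0 2 = v 0 2 -> u = v.
Proof. by move=> e0 e1 e2; rewrite (vec3_eta u) e0 e1 e2 -vec3_eta. Qed.

Lemma ord3_ind (P : 'I_3 -> Prop) : P 0 -> P 1 -> P 2 -> forall i, P i.
Proof.
move=> p0 p1 p2 [[|[|[|//]]] h].
- by rewrite (_ : Ordinal h = 0) //; apply/val_inj.
- by rewrite (_ : Ordinal h = 1) //; apply/val_inj.
- by rewrite (_ : Ordinal h = 2) //; apply/val_inj.
Qed.

Lemma sum_ord3 (V : nmodType) (F : 'I_3 -> V) :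
  \sum_i F i = F 0 + F 1 + F 2.
Proof.
rewrite !big_ord_recr /= big_ord0 add0r; congr (_ + _ + _); congr F;
  exact/val_inj.
Qed.

Lemma hplaneB (V : comNzRingType) (u v : 'rV[V]_3) :
  hplane u -> hplane v -> hplane (u - v).
Proof.
rewrite /hplane /= !mxE => u0 v0.
transitivity ((u 0 0 + u 0 1 + u 0 2) - (v 0 0 + v 0 1 + v 0 2)); first by ring.
by rewrite u0 v0 subrr.
Qed.

End Coordinates.

Section ThetaKernel.
Variable R : realType.
Implicit Types (t : 'rV[R]_3) (k : 'rV[int]_3).

Definition ang1 t : R := pi * (t 0 0 - t 0 1) / 3.
Definition ang2 t : R := pi * (t 0 1 - t 0 2) / 3.
Definition ang3 t : R := pi * (t 0 2 - t 0 0) / 3.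

Lemma ang_sum t : ang1 t + ang2 t + ang3 t = 0.
Proof. by rewrite /ang1 /ang2 /ang3; ring. Qed.

Lemma Theta_numE (p : nat) t : Theta_num (p%:Z - 1) t =
  sinratio p (ang1 t) * sinratio p (ang2 t) * sinratio p (ang3 t) * Theta_den t.
Proof.
rewrite /Theta_num /Theta_den addrNK -(pmulrn 1 p).
have e (u : R) : p%:R * pi * u / 3 = p%:R * (pi * u / 3) by ring.
by rewrite !e -!sinratioE /ang1 /ang2 /ang3; ring.
Qed.

Lemma continuous_coord (i : 'I_3) : continuous (fun t : 'rV[R]_3 => t 0 i).
Proof. exact: coord_continuous. Qed.

Lemma continuous_ang (i j : 'I_3) :
  continuous (fun t : 'rV[R]_3 => pi * (t 0 i - t 0 j) / 3 : R).
Proof.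
move=> t.
have cd : {for t, continuous (fun s : 'rV[R]_3 => s 0 i - s 0 j)}.
  exact: (@continuousB R R^o _ _ _ _ (@continuous_coord i t)
    (@continuous_coord j t)).
exact: (continuousM (continuousM (@cst_continuous _ R pi t) cd)
  (@cst_continuous _ R 3^-1 t)).
Qed.

Lemma continuous_sinratio_prod p : continuous (fun t : 'rV[R]_3 =>
  sinratio p (ang1 t) * sinratio p (ang2 t) * sinratio p (ang3 t)).
Proof.
have c (i j : 'I_3) : continuous
    (fun t : 'rV[R]_3 => sinratio p (pi * (t 0 i - t 0 j) / 3)).
  move=> t; exact: (@continuous_comp _ _ _ _ (sinratio p) t
    (@continuous_ang i j t) (@continuous_sinratio R p _)).
move=> t.
exact: (continuousM (continuousM (@c 0 1 t) (@c 1 2 t)) (@c 2 0 t)).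
Qed.

(** A zero of the sine is isolated: there the cosine is nonzero, and
    sin (x + d) = cos x * sin d. *)
Lemma sin_right_neq0 (x c : R) : 0 < c ->
  \forall e \near 0^'+, sin (x + c * e) != 0.
Proof.
move=> c0; have [sx|sx] := eqVneq (sin x) 0; last first.
  apply: (@cvg_at_right_filter _ _ (fun e : R => sin (x + c * e)) 0 _ _
    [set y | y != 0]).
    apply: continuous_comp; last exact: continuous_sin.
    by apply: cvgD; [exact: cvg_cst | exact: mulrl_continuous].
  rewrite /= mulr0 addr0.
  by apply: open_nbhs_nbhs; split => //; apply: open_neq.
near=> e.
have e0 : 0 < e by near: e; exact: nbhs_right_gt.
have e1 : e < pi / c by near: e; apply: nbhs_right_lt; rewrite divr_gt0 ?pi_gt0.
rewrite sinD sx mul0r add0r mulf_neq0 //.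
  by rewrite -normr_eq0 (sin0cos1 sx) oner_eq0.
by rewrite gt_eqF// sin_gt0_pi// mulr_gt0//= mulrC -ltr_pdivlMr.
Unshelve. all: by end_near. Qed.

(** Density makes the filter in the definition of Theta proper, so that its
    limit is the value of any continuous extension of the quotient. *)
Lemma regular_dense t : hplane t ->
  closure [set s | hplane s /\ Theta_den s != 0] t.
Proof.
move=> ht B tB.
(* Moving along (0,1,-1) changes all three differences of coordinates. *)
pose g (e : R) := t + e *: vec3 0 1 (- 1).
have gt : g e @[e --> 0^'+] --> t.
  apply: cvg_at_right_filter.
  have -> : t = g 0 by rewrite /g scale0r addr0.
  by apply: cvgD; [exact: cvg_cst | exact: scalel_continuous].
have hp : forall e, hplane (g e).
  by move=> e; rewrite /hplane /= !mxE /= -[RHS]ht; ring.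
have den : \forall e \near 0^'+, Theta_den (g e) != 0.
  near=> e; rewrite /Theta_den !mulf_neq0//.
  - rewrite (_ : _ / 3 = - (- ang1 t + pi / 3 * e)).
      rewrite sinN oppr_eq0; near: e; apply: sin_right_neq0.
      by rewrite divr_gt0 ?pi_gt0.
    by rewrite /g !mxE /= /ang1; ring.
  - rewrite (_ : _ / 3 = ang2 t + 2 * pi / 3 * e).
      by near: e; apply: sin_right_neq0; rewrite divr_gt0 ?mulr_gt0 ?pi_gt0.
    by rewrite /g !mxE /= /ang2; ring.
  - rewrite (_ : _ / 3 = - (- ang3 t + pi / 3 * e)).
      rewrite sinN oppr_eq0; near: e; apply: sin_right_neq0.
      by rewrite divr_gt0 ?pi_gt0.
    by rewrite /g !mxE /= /ang3; ring.
have : \forall e \near 0^'+, B (g e) by exact: gt.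
move=> Bg.
have [e [Be de]] : exists e : R, B (g e) /\ Theta_den (g e) != 0.
  by apply: (@filter_ex _ (0 : R)^'+); exact: filterI.
by exists (g e).
Unshelve. all: by end_near. Qed.

Lemma ThetaE (p : nat) t : hplane t -> Theta (p%:Z - 1) t =
  sinratio p (ang1 t) * sinratio p (ang2 t) * sinratio p (ang3 t).
Proof.
move=> ht; rewrite /Theta /=; case: eqP => [d0|/eqP d0]; last first.
  by rewrite Theta_numE mulfK.
have PF := within_nbhs_proper (regular_dense ht).
apply: cvg_lim => //.
have c := @cvg_within_filter _ _ _ (nbhs t) (nbhs_filter t) _
  [set s | hplane s /\ Theta_den s != 0] (@continuous_sinratio_prod p t).
apply: (cvg_trans _ c); apply: near_eq_cvg.
by rewrite near_withinE; near=> s => -[_ ds]; rewrite Theta_numE mulfK.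
Unshelve. all: by end_near. Qed.

Definition edge1 t : R[i] := expi (2 * ang1 t).
Definition edge2 t : R[i] := expi (2 * ang2 t).
Definition edge3 t : R[i] := expi (2 * ang3 t).

Lemma edge_prod t : edge1 t * edge2 t * edge3 t = 1.
Proof. by rewrite /edge1 -!expiD -!mulrDr ang_sum mulr0 expi0. Qed.

(** The sum of edge1^a edge2^b edge3^c over 0 <= a, b, c < p. *)
Definition cubesum p t : R[i] :=
  gsum p (edge1 t) * gsum p (edge2 t) * gsum p (edge3 t).

Lemma Theta_cubesum p t : hplane t -> (Theta (p%:Z - 1) t)%:C = cubesum p t.
Proof.
by move=> ht; rewrite ThetaE// /cubesum -(gsum_prod _ (ang_sum t)).
Qed.

(** The frequency of edge1^a edge2^b edge3^c; it depends on the triple only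
    modulo (1,1,1). *)
Definition tri (a b c : int) : 'rV[int]_3 := vec3 (a - c) (b - a) (c - b).

Lemma phiE k t : phi k t = expi (2 * pi / 3 *
  ((k 0 0)%:~R * t 0 0 + (k 0 1)%:~R * t 0 1 + (k 0 2)%:~R * t 0 2)).
Proof. by rewrite /phi sum_ord3. Qed.

Lemma phi_tri (a b c : nat) t :
  phi (tri a b c) t = edge1 t ^+ a * edge2 t ^+ b * edge3 t ^+ c.
Proof.
rewrite phiE /edge1 /edge2 /edge3 -!expiMn -!expiD; congr expi.
rewrite !vec3E !intrB -!pmulrn /ang1 /ang2 /ang3; ring.
Qed.
End ThetaKernel.

(** * The Dirichlet kernel of the hexagon *)

Section Hexagon.
Variable m : nat.
Let cube := ('I_m.+1 * 'I_m.+1 * 'I_m.+1)%type.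

Definition on_walls (x : cube) : bool :=
  [|| x.1.1 == 0 :> nat, x.1.2 == 0 :> nat | x.2 == 0 :> nat].

Definition cube_tri (x : cube) : 'rV[int]_3 := tri x.1.1 x.1.2 x.2.

Lemma hexagon_bij : set_bij [set` on_walls] (Hstar m) cube_tri.
Proof.
split.
- move=> [[a b] c]; rewrite /on_walls /cube_tri /=.
  have := ltn_ord a; have := ltn_ord b; have := ltn_ord c.
  move=> *; split; first by rewrite /hplane /= !vec3E; lia.
  by elim/ord3_ind; rewrite !vec3E; lia.
- move=> [[a b] c] [[a' b'] c']; rewrite !inE /cube_tri /= => w w' e.
  move: w w'; rewrite /in_mem /= /on_walls /= => w w'.
  have e0 := congr1 (fun v : 'rV[int]_3 => v 0 0) e.
  have e1 := congr1 (fun v : 'rV[int]_3 => v 0 1) e.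
  rewrite /= !vec3E in e0 e1.
  by congr (_, _, _); apply/val_inj => /=; lia.
- move=> k [kH kb]; rewrite /hplane /= in kH.
  have := kb 0; have := kb 1; have := kb 2.
  move ek0: (k 0 0) kH => k0; move ek1: (k 0 1) => k1.
  move ek2: (k 0 2) => k2 kH b2 b1 b0.
  (* The triple (k0, k0 + k1, 0) represents k; subtract its minimum. *)
  have [a [b [c [[ha hb hc ek] w]]]] : exists a b c : nat,
      [/\ (a < m.+1)%N, (b < m.+1)%N, (c < m.+1)%N &
        [/\ a%:Z - c%:Z = k0, b%:Z - a%:Z = k1 & c%:Z - b%:Z = k2]]
      /\ [|| a == 0, b == 0 | c == 0]%N.
    have [h|h] := boolP ((0 <= k0) && (0 <= k0 + k1)).
      exists (absz k0), (absz (k0 + k1)), 0%N.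
      by split; [split; [| | |split]|]; lia.
    have [h'|h'] := boolP ((k0 <= 0) && (0 <= k1)).
      exists 0%N, (absz k1), (absz k0).
      by split; [split; [| | |split]|]; lia.
    exists (absz k1), 0%N, (absz (k0 + k1)).
    by split; [split; [| | |split]|]; lia.
  exists (Ordinal ha, Ordinal hb, Ordinal hc) => //.
  by case: ek => ea eb ec; apply: vec3P; rewrite vec3E /= ?ek0 ?ek1 ?ek2.
Qed.

Lemma finite_Hstar : finite_set (Hstar m).
Proof.
have [hf _ hs] := hexagon_bij; apply: sub_finite_set hs _.
exact: finite_image.
Qed.

Variable R : realType.

Lemma sum_cube (P : pred 'I_m.+1) (A B C : R[i]) :
  (\sum_(a < m.+1 | P a) A ^+ a) * (\sum_(b < m.+1 | P b) B ^+ b) *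
  (\sum_(c < m.+1 | P c) C ^+ c) =
  \sum_(x : cube | [&& P x.1.1, P x.1.2 & P x.2])
     A ^+ x.1.1 * B ^+ x.1.2 * C ^+ x.2.
Proof.
rewrite big_distrlr pair_big /= big_distrlr pair_big /=.
by apply: eq_bigl => x; rewrite andbA.
Qed.

Lemma gsum_tail (w : R[i]) :
  \sum_(a < m.+1 | a != 0 :> nat) w ^+ a = w * gsum m w.
Proof.
rewrite big_mkcond big_ord_recl /= add0r /gsum big_distrr /=.
by apply: eq_bigr => a _; rewrite exprS.
Qed.

(** Reducing triples modulo (1,1,1), the cube of side m covers every frequency
    of the hexagon once by its points on the coordinate walls, while the rest
    of the cube is the translate by (1,1,1) of the cube of side m-1. *)
Lemma hexagon_sum (t : 'rV[R]_3) :
  \sum_(k \in Hstar m) phi k t = cubesum m.+1 t - cubesum m t.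
Proof.
rewrite (reindex_fsbig cube_tri _ _ _ hexagon_bij).
rewrite -(bigfs _ (index_enum_uniq cube)) /=; last first.
  by move=> x _; rewrite mem_index_enum.
under eq_bigr do rewrite phi_tri.
apply: (canRL (addrK _)).
rewrite /cubesum [in RHS]/gsum (sum_cube predT) [RHS](bigID on_walls) /=.
congr (_ + _); rewrite -[LHS]mul1r -(edge_prod t).
transitivity (edge1 t * gsum m (edge1 t) * (edge2 t * gsum m (edge2 t)) *
  (edge3 t * gsum m (edge3 t))); first by ring.
rewrite -!gsum_tail sum_cube; apply: eq_bigl => x.
by rewrite /on_walls !negb_or.
Qed.
End Hexagon.

(** * The weighted hexagonal kernel *)

Section CardinalWeights.
Variable n' : nat.
Let n := n'.+1.

Definition hexvertices : seq 'rV[int]_3 :=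
  [:: tri n 0 0; tri 0 n 0; tri 0 0 n; tri n n 0; tri n 0 n; tri 0 n n].

Lemma HopenS : Hopen n = Hstar n'.
Proof.
by apply/seteqP; split=> k [kH kb]; split=> // i; have := kb i; rewrite /n; lia.
Qed.

Lemma HstarS : Hstar n' `<=` Hstar n.
Proof. by move=> k [kH kb]; split=> // i; have := kb i; rewrite /n; lia. Qed.

Lemma HstarP m (k : 'rV[int]_3) : Hstar m k <->
  [/\ k 0 0 + k 0 1 + k 0 2 = 0, - m%:Z <= k 0 0 <= m%:Z,
      - m%:Z <= k 0 1 <= m%:Z & - m%:Z <= k 0 2 <= m%:Z].
Proof.
split=> [[kH kb]|[kH b0 b1 b2]]; first by split.
by split=> //; elim/ord3_ind.
Qed.

Lemma hexvertices_uniq : uniq hexvertices.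
Proof.
have neq (a b c a' b' c' : int) : (a - c != a' - c') || (b - a != b' - a') ->
    (tri a b c == tri a' b' c') = false.
  move=> d; apply/eqP => e; move: d.
  have := congr1 (fun v : 'rV[int]_3 => v 0 0) e.
  have := congr1 (fun v : 'rV[int]_3 => v 0 1) e.
  by rewrite /= !vec3E => -> ->; rewrite !eqxx.
by rewrite /= !inE /n !neq //; lia.
Qed.

(** On the boundary of the hexagon, the points with a vanishing coordinate are
    exactly its vertices. *)
Lemma hexverticesE (k : 'rV[int]_3) : Hstar n k ->
  (k \in hexvertices) = (k \notin Hstar n') && (k 0 0 * k 0 1 * k 0 2 == 0).
Proof.
move=> /HstarP[kH b0 b1 b2]; apply/idP/andP.
  rewrite !inE => h; split.
    apply/negP; rewrite inE => /HstarP[_].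
    by case/or4P: h => [|||/or3P[]] /eqP ->; rewrite !vec3E /n; lia.
  by case/or4P: h => [|||/or3P[]] /eqP ->; rewrite !vec3E ?subrr ?mulr0 ?mul0r.
case=> /negP; rewrite inE => no.
have {}no : ~~ [&& - n'%:Z <= k 0 0 <= n'%:Z, - n'%:Z <= k 0 1 <= n'%:Z
    & - n'%:Z <= k 0 2 <= n'%:Z].
  by apply/negP => /and3P[h0 h1 h2]; apply: no; apply/HstarP.
have mem (a b c : nat) : k 0 0 = a%:Z - c%:Z -> k 0 1 = b%:Z - a%:Z ->
    k == tri a b c.
  move=> e0 e1; apply/eqP/vec3P; rewrite vec3E //.
  by move: kH e0 e1; move: (k 0 0) (k 0 1) (k 0 2) => x y z; lia.
rewrite !mulf_eq0 !inE; move: b0 b1 b2 no; rewrite /n => b0 b1 b2 no.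
case/orP => [/orP[]|] /eqP z.
- have [s|s] := leP 0 (k 0 1).
    by rewrite (mem 0%N n'.+1 0%N) ?orbT //; lia.
  by rewrite (mem n'.+1 0%N n'.+1) ?orbT //; lia.
- have [s|s] := leP 0 (k 0 0).
    by rewrite (mem n'.+1 n'.+1 0%N) ?orbT //; lia.
  by rewrite (mem 0%N 0%N n'.+1) ?orbT //; lia.
- have [s|s] := leP 0 (k 0 0).
    by rewrite (mem n'.+1 0%N 0%N) ?orbT //; lia.
  by rewrite (mem 0%N n'.+1 n'.+1) ?orbT //; lia.
Qed.

Variable R : realType.
Implicit Types t : 'rV[R]_3.

(** Half the closed hexagon plus half the open one gives 1 inside and 1/2 on the
    boundary; the vertices need 1/3 = 1/2 - 1/6. *)
Lemma cweightE (k : 'rV[int]_3) (z : R[i]) : Hstar n k ->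
  cweight R n k * z = 2^-1 * z + 2^-1 * (if k \in Hstar n' then z else 0)
    - 6^-1 * (if k \in [set` hexvertices] then z else 0).
Proof.
move=> kH; rewrite /cweight mem_setE (hexverticesE kH) HopenS.
have [kin|kout] /= := boolP (k \in Hstar n').
  by rewrite mulr0 subr0 -mulrDl; congr (_ * _); field.
by case: eqP => /= _; [field | rewrite !mulr0 subr0 addr0].
Qed.

(** Three times the conjugate of TC_{n,0,-n}. *)
Definition edgepow t : R[i] :=
  edge1 t ^+ n + edge2 t ^+ n + edge3 t ^+ n.

Lemma conj_edge t : ((edge1 t)^* = edge2 t * edge3 t) *
  ((edge2 t)^* = edge1 t * edge3 t) * ((edge3 t)^* = edge1 t * edge2 t).
Proof.
have e := edge_prod t.
have i1 : edge1 t * (edge1 t)^* = 1 by exact: expiNM.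
have i2 : edge2 t * (edge2 t)^* = 1 by exact: expiNM.
have i3 : edge3 t * (edge3 t)^* = 1 by exact: expiNM.
split; [split|].
- rewrite -[LHS]mul1r -e; transitivity (edge1 t * (edge1 t)^* *
    (edge2 t * edge3 t)); [by ring | by rewrite i1 mul1r].
- rewrite -[LHS]mul1r -e; transitivity (edge2 t * (edge2 t)^* *
    (edge1 t * edge3 t)); [by ring | by rewrite i2 mul1r].
- rewrite -[LHS]mul1r -e; transitivity (edge3 t * (edge3 t)^* *
    (edge1 t * edge2 t)); [by ring | by rewrite i3 mul1r].
Qed.

Lemma sum_hexvertices t :
  \sum_(k <- hexvertices) phi k t = edgepow t + (edgepow t)^*.
Proof.
rewrite /hexvertices !big_cons big_nil.
rewrite (phi_tri n 0 0) (phi_tri 0 n 0) (phi_tri 0 0 n).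
rewrite (phi_tri n n 0) (phi_tri n 0 n) (phi_tri 0 n n).
by rewrite /edgepow !rmorphD !rmorphXn /= !conj_edge !exprMn !expr0; ring.
Qed.

Lemma PhistarE t : Phistar n t = (3 * n%:R ^+ 2)^-1 *
  (2^-1 * (cubesum n.+1 t - cubesum n' t)
   - 6^-1 * (edgepow t + (edgepow t)^*)).
Proof.
rewrite /Phistar; congr (_ * _).
rewrite -sum_hexvertices (fsbig_seq _ _ hexvertices_uniq).
have Hn := finite_Hstar n.
have -> : cubesum n.+1 t - cubesum n' t =
  \sum_(k \in Hstar n) phi k t + \sum_(k \in Hstar n') phi k t.
  by rewrite !hexagon_sum; ring.
have sub (J : set 'rV[int]_3) : J `<=` Hstar n ->
    \sum_(k \in J) phi k t =
    \sum_(k \in Hstar n) if k \in J then phi k t else 0.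
  by move=> JI; rewrite -{1}(setIidr JI) (@fsbig_mkcondr _ _ _ _ (Hstar n) J).
have vsub : [set` hexvertices] `<=` Hstar n.
  move=> k /=; rewrite !inE => h; apply/HstarP.
  by case/or4P: h => [|||/or3P[]] /eqP ->; rewrite !vec3E; split; lia.
rewrite (sub _ HstarS) (sub _ vsub) !fsbig_finite //.
rewrite mulrDr !mulr_sumr -big_split -sumrB /=.
apply: eq_big_seq => k; rewrite in_fset_set // inE; exact: cweightE.
Qed.
End CardinalWeights.

(** * Values of the weighted kernel at the nodes *)

Section NodalValues.
Variable R : realType.
Implicit Types A B C z : R[i].

Lemma gsum_geom p A : (A - 1) * gsum p A = A ^+ p - 1.
Proof. by rewrite subrX1. Qed.

Lemma gsum1 p : gsum p (1 : R[i]) = p%:R.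
Proof.
rewrite /gsum; under eq_bigr do rewrite expr1n.
by rewrite sumr_const card_ord.
Qed.

(** Here n = n'.+1 and z is the common n-th power.  Clearing the denominators
    (A - 1)(B - 1)(C - 1) of the geometric sums turns the claim into an identity
    between the elementary symmetric functions of A, B, C. *)
Lemma gsum_prod_generic (n' : nat) A B C z :
  A * B * C = 1 -> z ^+ 3 = 1 -> A ^+ n'.+1 = z -> B ^+ n'.+1 = z ->
  C ^+ n'.+1 = z -> A != 1 -> B != 1 -> C != 1 ->
  gsum n'.+2 A * gsum n'.+2 B * gsum n'.+2 C
  - gsum n' A * gsum n' B * gsum n' C = z + z ^+ 2.
Proof.
move=> abc z3 az bz cz a1 b1 c1.
have up (w : R[i]) : w ^+ n'.+1 = z -> (w - 1) * gsum n'.+2 w = w * z - 1.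
  by move=> wz; rewrite gsum_geom exprS wz.
have down (w : R[i]) : w ^+ n'.+1 = z -> (w - 1) * (w * gsum n' w) = z - w.
  by move=> wz; rewrite mulrCA gsum_geom mulrBr mulr1 -exprS wz.
have P0 : (A - 1) * (B - 1) * (C - 1) != 0 by rewrite !mulf_neq0 ?subr_eq0.
apply: (mulfI P0); rewrite mulrBr.
(* A B C = 1 provides the factors that the shorter sums need. *)
transitivity (((A - 1) * gsum n'.+2 A) * ((B - 1) * gsum n'.+2 B)
    * ((C - 1) * gsum n'.+2 C)
  - ((A - 1) * (A * gsum n' A)) * ((B - 1) * (B * gsum n' B))
    * ((C - 1) * (C * gsum n' C))).
  congr (_ - _); first by ring.
  by rewrite -[LHS]mul1r -abc; ring.
rewrite !up // !down //.
transitivity (z ^+ 3 * (A * B * C) - 1 - z ^+ 3 + A * B * C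
  + (z + z ^+ 2) * (A + B + C - A * B - B * C - C * A)); first by ring.
transitivity ((z + z ^+ 2) *
  (A * B * C - 1 + A + B + C - A * B - B * C - C * A));
  last by ring.
by rewrite abc z3; ring.
Qed.

(** One of the three bases is 1 and its geometric sum counts terms; the common
    power is then 1 as well. *)
Lemma gsum_prod_wall (n' : nat) B C : B * C = 1 -> B ^+ n'.+1 = 1 -> B != 1 ->
  gsum n'.+2 1 * gsum n'.+2 B * gsum n'.+2 C
  - gsum n' 1 * gsum n' B * gsum n' C = 2 :> R[i].
Proof.
move=> bc bn b1.
have c1 : C != 1 by apply: contraNneq b1 => c1; rewrite -bc c1 mulr1.
have cn : C ^+ n'.+1 = 1.
  by rewrite -[LHS]mul1r -bn -exprMn bc expr1n.
have up (w : R[i]) : w ^+ n'.+1 = 1 -> w != 1 -> gsum n'.+2 w = 1.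
  move=> wn w1; have w10 : w - 1 != 0 by rewrite subr_eq0.
  apply: (mulfI w10).
  by rewrite gsum_geom exprS wn !mulr1.
have down (w : R[i]) : w ^+ n'.+1 = 1 -> w != 1 -> w * gsum n' w = - 1.
  move=> wn w1; have w10 : w - 1 != 0 by rewrite subr_eq0.
  apply: (mulfI w10).
  by rewrite [LHS]mulrCA gsum_geom mulrBr -exprS wn; ring.
rewrite !gsum1 (up B) // (up C) // !mulr1 -mulrA.
have -> : gsum n' B * gsum n' C = 1.
  rewrite -[LHS]mul1r -{1}bc.
  transitivity ((B * gsum n' B) * (C * gsum n' C)); first by ring.
  by rewrite !down // mulrNN mulr1.
by rewrite -[in X in X - _]addn2 natrD; ring.
Qed.

Lemma gsum_prod_root (n' : nat) A B C z :
  A * B * C = 1 -> z ^+ 3 = 1 -> A ^+ n'.+1 = z -> B ^+ n'.+1 = z ->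
  C ^+ n'.+1 = z -> ~~ ((A == 1) && (B == 1)) ->
  gsum n'.+2 A * gsum n'.+2 B * gsum n'.+2 C
  - gsum n' A * gsum n' B * gsum n' C = z + z ^+ 2.
Proof.
move=> abc z3 az bz cz.
have [a1|a1] /= := eqVneq A 1.
  have z1 : z = 1 by rewrite -az a1 expr1n.
  move: abc; rewrite a1 mul1r => bc b1; rewrite gsum_prod_wall ?bz //.
  by rewrite z1 expr1n.
move=> _; have [b1|b1] := eqVneq B 1.
  have z1 : z = 1 by rewrite -bz b1 expr1n.
  move: abc; rewrite b1 mulr1 => ac.
  rewrite [gsum _ A * _]mulrC [gsum n' A * _]mulrC gsum_prod_wall ?az //.
  by rewrite z1 expr1n.
have [c1|c1] := eqVneq C 1; last exact: gsum_prod_generic.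
have z1 : z = 1 by rewrite -cz c1 expr1n.
move: abc; rewrite c1 mulr1 => ab.
rewrite [gsum _ A * _ * _]mulrC [gsum n' A * _ * _]mulrC !mulrA.
by rewrite gsum_prod_wall ?az // z1 expr1n.
Qed.

Variable n' : nat.
Let n := n'.+1.
Implicit Type d : 'rV[int]_3.

Lemma edge_node d :
  ((edge1 (node R n d) = expi (2 * pi * ((d 0 0 - d 0 1)%:~R / (3 * n)%:R))) *
   (edge2 (node R n d) = expi (2 * pi * ((d 0 1 - d 0 2)%:~R / (3 * n)%:R))) *
   (edge3 (node R n d) = expi (2 * pi * ((d 0 2 - d 0 0)%:~R / (3 * n)%:R))))%type.
Proof.
have n0 : n%:R != 0 :> R by rewrite pnatr_eq0.
by split; [split|]; congr expi;
  rewrite /ang1 /ang2 /ang3 !mxE intrB natrM; field.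
Qed.

Lemma expi_node_eq1 (q : int) :
  (expi (2 * pi * (q%:~R / (3 * n)%:R) : R) == 1) = ((3 * n)%N%:Z %| q)%Z.
Proof.
apply/eqP/idP => [|/dvdzP[c ->]]; first exact: expi_2piz_eq1.
rewrite intrM -[(_%:Z)%:~R]pmulrn mulfK ?pnatr_eq0 //; exact: expi_2piz.
Qed.

(** On the lattice plane the three differences of coordinates are congruent
    modulo 3, hence the three edge exponentials have the same n-th power. *)
Lemma edge_node_pow d : hplane d -> exists z : R[i], [/\ z ^+ 3 = 1,
  edge1 (node R n d) ^+ n = z, edge2 (node R n d) ^+ n = z &
  edge3 (node R n d) ^+ n = z].
Proof.
move=> dH; have n0 : n%:R != 0 :> R by rewrite pnatr_eq0.
have pw (q : int) : expi (2 * pi * (q%:~R / (3 * n)%:R) : R) ^+ n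
    = expi (2 * pi / 3 * q%:~R).
  by rewrite -expiMn natrM; congr expi; field.
have per (q r : int) : expi (2 * pi / 3 * (q + 3 * r)%:~R : R)
    = expi (2 * pi / 3 * q%:~R).
  rewrite -[RHS]mulr1 -(expi_2piz R r) -expiD intrD intrM.
  by congr expi; field.
exists (expi (2 * pi / 3 * (d 0 0 - d 0 1)%:~R)).
rewrite !edge_node !pw; split=> //.
- rewrite -expiMn -(expi_2piz R (d 0 0 - d 0 1)); congr expi; by field.
- rewrite -[RHS](per _ (d 0 1)); congr (expi (_ * _%:~R)).
  by move: dH; rewrite /hplane /=; move: (d 0 0) (d 0 1) (d 0 2) => x y z; lia.
- rewrite -[RHS](per _ (- d 0 0)); congr (expi (_ * _%:~R)).
  by move: dH; rewrite /hplane /=; move: (d 0 0) (d 0 1) (d 0 2) => x y z; lia.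
Qed.

(** For d in the lattice plane, d / n is then a common period of all phi_k. *)
Definition in_period d : bool :=
  ((3 * n)%N%:Z %| (d 0 0 - d 0 1)%R)%Z &&
  ((3 * n)%N%:Z %| (d 0 1 - d 0 2)%R)%Z.

(** Off the period lattice, 1/2 (z + z^2) from the cubes cancels against the
    vertex terms 1/6 * 3 (z + z^2); on it, everything is a count of terms. *)
Lemma Phistar_node d : hplane d -> Phistar n (node R n d) = (in_period d)%:R.
Proof.
move=> dH; rewrite PhistarE /edgepow !rmorphD !rmorphXn /= !conj_edge !exprMn.
have := edge_prod (node R n d); have [z [z3 e1 e2 e3]] := edge_node_pow dH.
rewrite /in_period -!(expi_node_eq1) -!edge_node !e1 !e2 !e3 /cubesum => abc.
have n0 : n%:R != 0 :> R[i] by rewrite pnatr_eq0.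
have [/andP[/eqP a1 /eqP b1]|no] := boolP (_ && _); last first.
  rewrite (gsum_prod_root abc z3) // (_ : _ - _ = 0) ?mulr0 //; first by field.
have c1 : edge3 (node R n d) = 1 by rewrite -abc a1 b1 !mul1r.
have z1 : z = 1 by rewrite -e1 a1 expr1n.
rewrite a1 b1 c1 !gsum1 z1.
have -> : n'.+2%:R = n%:R + 1 :> R[i] by rewrite natr1.
have -> : n'%:R = n%:R - 1 :> R[i] by rewrite -(natr1 n') addrK.
rewrite mulr1n; move: n0; rewrite /n.
by move: (n'.+1%:R) => x x0; field; exact: x0.
Qed.
End NodalValues.

(** * Orbits of the nodes under the isometries *)

Section Reflections.

(** The orbit over which P^+ averages, with multiplicity. *)
Definition images (V : zmodType) (v : 'rV[V]_3) : seq 'rV[V]_3 :=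
  let x := v 0 0 in let y := v 0 1 in let z := v 0 2 in
  [:: vec3 x y z; vec3 y z x; vec3 z x y;
      vec3 (- x) (- z) (- y); vec3 (- y) (- x) (- z); vec3 (- z) (- y) (- x)].

Lemma hplane_images (V : comNzRingType) (v : 'rV[V]_3) : hplane v ->
  {in images v, forall s, hplane s}.
Proof.
move=> v0 s; have {}v0 : v 0 0 + v 0 1 + v 0 2 = 0 := v0.
have vN : - (v 0 0 + v 0 1 + v 0 2) = 0 by rewrite v0 oppr0.
rewrite !inE => /or4P[|||/or3P[]] /eqP ->; rewrite /hplane /= !vec3E.
- by [].
- by rewrite -v0; ring.
- by rewrite -v0; ring.
- by rewrite -vN; ring.
- by rewrite -vN; ring.
- by rewrite -vN; ring.
Qed.

(** An image of a point of the triangle of side m and another point of it have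
    differences of coordinates in the range of this or the next two lemmas. *)
Lemma dvd_period0 (m : nat) (x : int) : - (3 * m%:Z) < x -> x < 3 * m%:Z ->
  ((3 * m)%N%:Z %| x)%Z = (x == 0).
Proof.
move=> x1 x2; apply/dvdzP/eqP => [[q e]|->]; last by exists 0.
have q1 : q < 1 by nia.
have q2 : - 1 < q by nia.
have q0 : q = 0 by lia.
by rewrite e q0 mul0r.
Qed.

Lemma dvd_periodP (m : nat) (x : int) : - (3 * m%:Z) < x -> x < 6 * m%:Z ->
  ((3 * m)%N%:Z %| x)%Z = (x == 0) || (x == 3 * m%:Z).
Proof.
move=> x1 x2; apply/dvdzP/orP => [[q e]|].
  have q1 : q < 2 by nia.
  have q2 : - 1 < q by nia.
  have [q0|q0] : q = 0 \/ q = 1 by lia.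
  - by left; rewrite e q0 mul0r.
  - by right; rewrite e q0 mul1r PoszM.
by case=> /eqP ->; [exists 0 | exists 1; rewrite mul1r PoszM].
Qed.

Lemma dvd_periodN (m : nat) (x : int) : - (6 * m%:Z) < x -> x < 3 * m%:Z ->
  ((3 * m)%N%:Z %| x)%Z = (x == 0) || (x == - (3 * m%:Z)).
Proof.
move=> x1 x2; have -> : ((3 * m)%N%:Z %| x)%Z = ((3 * m)%N%:Z %| - x)%Z.
  by rewrite !dvdzE abszN.
rewrite dvd_periodP; [|lia|lia].
by rewrite oppr_eq0 eqr_oppLR.
Qed.

Section EquivalentImages.
Variables (m a b c d : nat).
Hypotheses (m0 : (0 < m)%N) (ab : (a + b <= m)%N) (cd : (c + d <= m)%N).

(** Equivalence modulo the period lattice of (x, y, z) and the node j with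
    coordinates c, d; the arguments below are the images of the node k with
    coordinates a, b.  They are equivalent to j only if k = j.  A rotation
    moreover requires j to be a corner of the triangle; a reflection, to be on
    one side or at the opposite corner. *)
Let equiv (x y z : int) : bool :=
  ((3 * m)%N%:Z %| (x - y - c%:Z + d%:Z)%R)%Z &&
  ((3 * m)%N%:Z %| (y - z - c%:Z - d%:Z - d%:Z)%R)%Z.
Let s : int := a%:Z + b%:Z.
Let corner : bool :=
  [|| (c == m) && (d == 0), (c == 0) && (d == m) | (c == 0) && (d == 0)]%N.

Lemma equiv_id : equiv a%:Z b%:Z (- s) = (a == c) && (b == d).
Proof. by rewrite /equiv /s !dvd_period0; lia. Qed.

Lemma equiv_rot1 : equiv b%:Z (- s) a%:Z = (a == c) && (b == d) && corner.
Proof. by rewrite /equiv /s /corner dvd_periodP ?dvd_periodN; lia. Qed.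

Lemma equiv_rot2 : equiv (- s) a%:Z b%:Z = (a == c) && (b == d) && corner.
Proof. by rewrite /equiv /s /corner !dvd_periodN; lia. Qed.

Lemma equiv_refl1 : equiv (- a%:Z) (- - s) (- b%:Z) =
  (a == c) && (b == d) && ((c == 0) || (c == m))%N.
Proof. by rewrite /equiv /s dvd_periodN ?dvd_period0; lia. Qed.

Lemma equiv_refl2 : equiv (- b%:Z) (- a%:Z) (- - s) =
  (a == c) && (b == d) && ((c + d == 0) || (c + d == m))%N.
Proof. by rewrite /equiv /s dvd_period0 ?dvd_periodN; lia. Qed.

Lemma equiv_refl3 : equiv (- - s) (- b%:Z) (- a%:Z) =
  (a == c) && (b == d) && ((d == 0) || (d == m))%N.
Proof. by rewrite /equiv /s dvd_periodP ?dvd_periodN; lia. Qed.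
End EquivalentImages.

Variable n' : nat.
Let n := n'.+1.
Implicit Types j k : 'rV[int]_3.

Lemma vec3_eq (T : eqType) (u : 'rV[T]_3) (a b c : T) :
  (u == vec3 a b c) = [&& u 0 0 == a, u 0 1 == b & u 0 2 == c].
Proof.
apply/eqP/and3P => [->|[/eqP e0 /eqP e1 /eqP e2]]; first by rewrite !vec3E.
by apply: vec3P; rewrite vec3E.
Qed.

Lemma LambdaP j : Lambda n j -> exists c d : nat,
  (c + d <= n)%N /\ j = vec3 c%:Z d%:Z (- (c%:Z + d%:Z)).
Proof.
case; rewrite /hplane /= => jH; case e0: (j 0 0) jH => [c|//].
case e1: (j 0 1) => [d|//] jH _ _ h.
exists c, d; split.
  by move: jH h; move: (j 0 2) => z; lia.
by apply: vec3P; rewrite vec3E //; move: jH; move: (j 0 2) => z; lia.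
Qed.

Lemma lambdaE (c d : nat) : (c + d <= n)%N ->
  lambda n (vec3 c%:Z d%:Z (- (c%:Z + d%:Z))) =
  if [|| c == 0, d == 0 | c + d == n]%N then
    if [|| (c == n) && (d == 0), (c == 0) && (d == n) | (c == 0) && (d == 0)]%N
    then 1%N else 3%N
  else 6%N.
Proof.
move=> cd; rewrite /lambda !inE !vec3_eq !vec3E.
have eq_if (p q p' q' : bool) : p = p' -> q = q' ->
    (if p then 6 else if q then 1 else 3)%N
    = (if p' then 6 else if q' then 1 else 3)%N by move=> -> ->.
by rewrite -[RHS]if_neg; apply: eq_if; lia.
Qed.

Lemma in_period_sub (x y z c d : int) :
  in_period n' (vec3 x y z - vec3 c d (- (c + d))) =
  ((3 * n)%N%:Z %| x - y - c + d)%Z && ((3 * n)%N%:Z %| y - z - c - d - d)%Z.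
Proof.
rewrite /in_period !mxE /=; congr ((_ %| _)%Z && (_ %| _)%Z); lia.
Qed.

(** The triangle is a fundamental domain of the group generated by the six
    isometries and the period lattice, and lambda counts the orbit: a node j has
    6 / lambda images that are equivalent to it modulo the lattice. *)
Lemma card_images j k : Lambda n j -> Lambda n k ->
  (lambda n j * \sum_(s <- images k) in_period n' (s - j)
   = if k == j then 6 else 0)%N.
Proof.
move=> /LambdaP[c [d [cd ->]]] /LambdaP[a [b [ab ->]]].
have n0 : (0 < n)%N by [].
rewrite /images !vec3E !big_cons big_nil !in_period_sub vec3_eq !vec3E.
rewrite (equiv_id n0 ab cd) (equiv_rot1 n0 ab cd) (equiv_rot2 n0 ab cd).
rewrite (equiv_refl1 n0 ab cd) (equiv_refl2 n0 ab cd) (equiv_refl3 n0 ab cd).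
rewrite lambdaE //.
have -> : [&& a == c :> int, b == d :> int & - (a%:Z + b%:Z) == - (c%:Z + d%:Z)]
  = (a == c) && (b == d) by lia.
case: ((a == c) && (b == d)) => /=; last by rewrite muln0.
(* Each incidence of the node is a conjunction of incidences with the three
   sides, which cannot all hold. *)
have cn : (c == n) = (d == 0%N) && (c + d == n)%N by lia.
have dn : (d == n) = (c == 0%N) && (c + d == n)%N by lia.
have z : (c + d == 0)%N = (c == 0%N) && (d == 0%N) by lia.
have : ~~ [&& c == 0%N, d == 0%N & (c + d == n)%N] by lia.
by rewrite cn dn z; case: (c == 0%N); case: (d == 0%N); case: (c + d == n)%N.
Qed.
End Reflections.

Lemma PplusE (R : realType) (f : 'rV[R]_3 -> R[i]) t :
  Pplus f t = 6^-1 * \sum_(s <- images t) f s.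
Proof. by rewrite /Pplus !big_cons big_nil addr0 !addrA. Qed.

Section Lagrange.
Variable R : realType.
Variable n' : nat.
Let n := n'.+1.

Lemma images_node m k : images (node R m k) = [seq node R m s | s <- images k].
Proof.
have v (a b c : int) : node R m (vec3 a b c) =
    vec3 (m%:R^-1 * a%:~R) (m%:R^-1 * b%:~R) (m%:R^-1 * c%:~R).
  by apply: vec3P; rewrite !mxE.
by rewrite /images /= !v !mxE !intrN !mulrN.
Qed.

Lemma ellDelta_node j k : Lambda n j -> Lambda n k ->
  ellDelta n j (node R n k) = (k == j)%:R.
Proof.
move=> jL kL; have jH : hplane j by case: jL.
have kH : hplane k by case: kL.
rewrite /ellDelta PplusE images_node big_map /ell.
rewrite (eq_big_seq (fun s => (in_period n' (s - j))%:R)) /=; last first.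
  move=> s sk; rewrite /node -scalerBr -map_mxB -/(node R n _).
  by rewrite Phistar_node //; exact: hplaneB (hplane_images kH sk) jH.
rewrite -natr_sum mulrCA -natrM card_images //.
by case: eqP => _; rewrite ?mulr0 ?mulVf ?pnatr_eq0.
Qed.

End Lagrange.

(** * The interpolation space and uniqueness *)

Section Span.
Variable R : realType.
Implicit Types (t : 'rV[R]_3) (k : 'rV[int]_3) (g h : 'rV[R]_3 -> R[i]).

Lemma TC_rot (a b c : int) : @TC R (vec3 b c a) =1 TC (vec3 a b c).
Proof.
move=> t; rewrite /TC /Pplus /= !phiE !vec3E; congr (_ * _).
set x := t 0 0; set y := t 0 1; set z := t 0 2.
transitivity (phi (vec3 a b c) (vec3 z x y) + phi (vec3 a b c) (vec3 x y z)
  + phi (vec3 a b c) (vec3 y z x) + phi (vec3 a b c) (vec3 (- y) (- x) (- z))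
  + phi (vec3 a b c) (vec3 (- z) (- y) (- x))
  + phi (vec3 a b c) (vec3 (- x) (- z) (- y))).
  by rewrite !phiE !vec3E; do ![congr (_ + _)]; congr expi; ring.
by rewrite !phiE !vec3E; ring.
Qed.

Lemma TC_refl (a b c : int) : @TC R (vec3 (- a) (- c) (- b)) =1 TC (vec3 a b c).
Proof.
move=> t; rewrite /TC /Pplus /= !phiE !vec3E; congr (_ * _).
set x := t 0 0; set y := t 0 1; set z := t 0 2.
transitivity (phi (vec3 a b c) (vec3 (- x) (- z) (- y))
  + phi (vec3 a b c) (vec3 (- y) (- x) (- z))
  + phi (vec3 a b c) (vec3 (- z) (- y) (- x))
  + phi (vec3 a b c) (vec3 x y z) + phi (vec3 a b c) (vec3 y z x)
  + phi (vec3 a b c) (vec3 z x y)).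
  by rewrite !phiE !vec3E !intrN; do ![congr (_ + _)]; congr expi; ring.
by rewrite !phiE !vec3E; ring.
Qed.

Lemma TC_images k : {in images k, forall s, @TC R s =1 TC k}.
Proof.
move=> s; rewrite [in TC k](vec3_eta k) !inE.
move=> /or4P[|||/or3P[]] /eqP -> t.
- by [].
- exact: TC_rot.
- by rewrite TC_rot TC_rot.
- exact: TC_refl.
- by rewrite TC_rot TC_rot TC_refl.
- by rewrite TC_rot TC_refl.
Qed.

Variable n : nat.

Lemma Lambda_Hstar : Lambda n `<=` Hstar n.
Proof.
move=> k [kH k0 k1 k2]; apply/HstarP; move: kH k0 k1 k2; rewrite /hplane /=.
by move: (k 0 0) (k 0 1) (k 0 2) => x y z *; split; lia.
Qed.

Lemma finite_Lambda : finite_set (Lambda n).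
Proof. exact: sub_finite_set Lambda_Hstar (finite_Hstar n). Qed.

(** The triangle is one of the six sectors of the hexagon, permuted
    transitively by the isometries. *)
Lemma Hstar_image k : Hstar n k -> exists2 s, s \in images k & Lambda n s.
Proof.
move=> /HstarP; rewrite /images.
move: (k 0 0) (k 0 1) (k 0 2) => x y z [s0 b0 b1 b2].
have L (a b c : int) : a + b + c = 0 -> 0 <= a -> 0 <= b -> - c <= n%:Z ->
  Lambda n (vec3 a b c) by move=> *; split; rewrite /hplane /= ?vec3E.
have [h|h0] := boolP ((0 <= x) && (0 <= y)).
  by exists (vec3 x y z); [rewrite !inE eqxx | apply: L; lia].
have [h|h1] := boolP ((0 <= y) && (0 <= z)).
  by exists (vec3 y z x); [rewrite !inE eqxx orbT | apply: L; lia].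
have [h|h2] := boolP ((0 <= z) && (0 <= x)).
  by exists (vec3 z x y); [rewrite !inE eqxx !orbT | apply: L; lia].
have [h|h3] := boolP ((x <= 0) && (z <= 0)).
  by exists (vec3 (- x) (- z) (- y)); [rewrite !inE eqxx !orbT | apply: L; lia].
have [h|h4] := boolP ((x <= 0) && (y <= 0)).
  by exists (vec3 (- y) (- x) (- z)); [rewrite !inE eqxx !orbT | apply: L; lia].
by exists (vec3 (- z) (- y) (- x)); [rewrite !inE eqxx !orbT | apply: L; lia].
Qed.

Lemma TCspan_ext g h : (forall t, hplane t -> g t = h t) ->
  TCspan n h -> TCspan n g.
Proof. by move=> gh [a ha]; exists a => t ht; rewrite gh ?ha. Qed.

Lemma TCspan_lin (z : R[i]) g h : TCspan n g -> TCspan n h ->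
  TCspan n (fun t => z * g t + h t).
Proof.
move=> [a ga] [b hb]; exists (fun k => z * a k + b k) => t ht.
have Lf := finite_Lambda.
rewrite ga // hb // !fsbig_finite //= mulr_sumr -big_split /=.
by apply: eq_bigr => k _; ring.
Qed.

Lemma TCspan0 : TCspan n (fun _ : 'rV[R]_3 => 0 : R[i]).
Proof.
by exists (fun=> 0) => t _; rewrite fsbig1 // => k _; rewrite mul0r.
Qed.

Lemma TCspan_sum (I : eqType) (r : seq I) (z : I -> R[i])
    (G : I -> 'rV[R]_3 -> R[i]) : {in r, forall i, TCspan n (G i)} ->
  TCspan n (fun t => \sum_(i <- r) z i * G i t).
Proof.
elim: r => [_|i r IH Gr].
  by apply: TCspan_ext TCspan0 => t _; rewrite big_nil.
apply: (@TCspan_ext _ (fun t => z i * G i t + \sum_(j <- r) z j * G j t)).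
  by move=> t _; rewrite big_cons.
apply: TCspan_lin; first by apply: Gr; rewrite mem_head.
by apply: IH => j jr; apply: Gr; rewrite inE jr orbT.
Qed.

Lemma TCspan_TC k : Hstar n k -> TCspan n (@TC R k).
Proof.
move=> /Hstar_image[s sk sL].
apply: (@TCspan_ext _ (TC s)) => [t _|]; first by rewrite (TC_images sk).
exists (fun l => (l == s)%:R) => t _.
rewrite (fsbigD1 s) //=; last exact: finite_Lambda.
rewrite eqxx mul1r fsbig1 ?addr0 // => l [_ /eqP ls].
by rewrite (negbTE ls) mul0r.
Qed.

Lemma phiB k t (u : 'rV[R]_3) : phi k (t - u) = phi k t * (phi k u)^*.
Proof. by rewrite !phiE -expiN -expiD; congr expi; rewrite !mxE; ring. Qed.

Lemma ellDelta_TC (j : 'rV[int]_3) t : ellDelta n j t =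
  \sum_(k <- fset_set (Hstar n)) ((lambda n j)%:R * (3 * n%:R ^+ 2)^-1 *
     cweight R n k * (phi k (node R n j))^*) * TC k t.
Proof.
have Hn := finite_Hstar n.
rewrite /ellDelta PplusE /ell /Phistar -mulr_sumr.
under eq_bigr do rewrite fsbig_finite //.
rewrite exchange_big /= !mulr_sumr; apply: eq_bigr => k _.
rewrite /TC PplusE !mulr_sumr; apply: eq_bigr => s _.
by rewrite phiB; ring.
Qed.

Lemma ellDelta_span (j : 'rV[int]_3) : TCspan n (@ellDelta R n j).
Proof.
apply: (TCspan_ext (fun t _ => ellDelta_TC j t)).
apply: TCspan_sum => k.
by rewrite in_fset_set ?inE; [exact: TCspan_TC | exact: finite_Hstar].
Qed.

Lemma Lstar_span (f : 'rV[R]_3 -> R[i]) : TCspan n (Lstar n f).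
Proof.
apply: (@TCspan_ext _ (fun t => \sum_(j <- fset_set (Lambda n))
    f (node R n j) * ellDelta n j t)).
  by move=> t _; rewrite /Lstar fsbig_finite //; exact: finite_Lambda.
by apply: TCspan_sum => j _; exact: ellDelta_span.
Qed.

Lemma hplane_node k : hplane k -> hplane (node R n k).
Proof.
rewrite /hplane /= !mxE => kH; rewrite -!mulrDr -!intrD.
by have -> : k 0 0 + k 0 1 + k 0 2 = 0 by []; rewrite mulr0.
Qed.
End Span.

Section Interpolation.
Variables (R : realType) (n' : nat).
Let n := n'.+1.

Lemma Lstar_node (f : 'rV[R]_3 -> R[i]) k : Lambda n k ->
  Lstar n f (node R n k) = f (node R n k).
Proof.
move=> kL; rewrite /Lstar (fsbigD1 k) //=; last exact: finite_Lambda.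
rewrite ellDelta_node // eqxx.
rewrite mulr1 fsbig1 ?addr0 // => j [jL /eqP jk].
by rewrite ellDelta_node // eq_sym (negbTE jk) mulr0.
Qed.

(** The matrix of nodal values of the TC_k is square, and the fundamental
    functions provide a right inverse of it; hence it is injective. *)
Lemma TCspan_eq0 (g : 'rV[R]_3 -> R[i]) : TCspan n g ->
  (forall j, Lambda n j -> g (node R n j) = 0) -> forall t, hplane t -> g t = 0.
Proof.
move=> [a ga] g0 t ht; have Lfin := finite_Lambda n.
set L : seq 'rV[int]_3 := fset_set (Lambda n).
have Luniq : uniq L by exact: fset_uniq.
have LL i : (i < size L)%N -> Lambda n L`_i.
  by move=> iL; have := mem_nth 0 iL; rewrite in_fset_set // inE.
have sumL (F : 'rV[int]_3 -> R[i]) :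
    \sum_(k \in Lambda n) F k = \sum_(i < size L) F L`_i.
  by rewrite fsbig_finite // (big_nth 0) big_mkord.
have nodeH i : (i < size L)%N -> hplane (node R n L`_i).
  by move=> iL; apply: hplane_node; case: (LL _ iL).
have [b hb] := choice (fun i : 'I_(size L) => @ellDelta_span R n L`_i).
pose M := \matrix_(i < size L, l < size L) TC L`_l (node R n L`_i)
  : 'M[R[i]]_(size L).
pose B := \matrix_(l < size L, i < size L) b i L`_l : 'M[R[i]]_(size L).
have MB : M *m B = 1%:M.
  apply/matrixP => i i'; rewrite !mxE.
  transitivity (ellDelta n L`_i' (node R n L`_i)).
    rewrite hb; last exact: nodeH.
    rewrite sumL; apply: eq_bigr => l _.
    by rewrite !mxE mulrC.
  by rewrite ellDelta_node ?nth_uniq //; exact: LL.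
pose v := \col_(l < size L) a L`_l.
have Mv : M *m v = 0.
  apply/colP => i; rewrite !mxE -[RHS](g0 L`_i); last exact: LL.
  rewrite ga; last exact: nodeH.
  rewrite sumL.
  by apply: eq_bigr => l _; rewrite !mxE mulrC.
have v0 : v = 0 by rewrite -[v]mul1mx -(mulmx1C MB) -mulmxA Mv mulmx0.
rewrite ga // sumL big1 // => l _.
by have /colP/(_ l) := v0; rewrite !mxE => ->; rewrite mul0r.
Qed.

Lemma Lstar_unique (f g : 'rV[R]_3 -> R[i]) : TCspan n g ->
  (forall j, Lambda n j -> g (node R n j) = f (node R n j)) ->
  forall t, hplane t -> g t = Lstar n f t.
Proof.
move=> gS gf t ht; apply/eqP; rewrite -subr_eq0; apply/eqP.
apply: (@TCspan_eq0 (fun t => g t - Lstar n f t)) => //.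
  apply: (@TCspan_ext _ _ _ (fun t => -1 * Lstar n f t + g t)).
    by move=> s _; rewrite mulN1r addrC.
  by apply: TCspan_lin => //; exact: Lstar_span.
by move=> j jL; rewrite gf // Lstar_node // subrr.
Qed.
End Interpolation.

(** * Closed form of the fundamental functions *)

Section ClosedForm.
Variables (R : realType) (n' : nat).
Let n := n'.+1.
Implicit Types t : 'rV[R]_3.

Lemma edgeB t (u : 'rV[R]_3) : ((edge1 (t - u) = edge1 t * (edge1 u)^*) *
  (edge2 (t - u) = edge2 t * (edge2 u)^*) *
  (edge3 (t - u) = edge3 t * (edge3 u)^*)).
Proof.
by split; [split|]; rewrite -expiN -expiD; congr expi;
  rewrite /ang1 /ang2 /ang3 !mxE; ring.
Qed.

(** Each of the six isometries permutes the three edge exponentials, and every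
    edge is hit twice in each position. *)
Lemma sum_images_edge (f : R[i] -> R[i]) t :
  ((\sum_(s <- images t) f (edge1 s) =
     2 * (f (edge1 t) + f (edge2 t) + f (edge3 t))) *
  (\sum_(s <- images t) f (edge2 s) =
     2 * (f (edge1 t) + f (edge2 t) + f (edge3 t))) *
  (\sum_(s <- images t) f (edge3 s) =
     2 * (f (edge1 t) + f (edge2 t) + f (edge3 t)))).
Proof.
rewrite /images !big_cons !big_nil.
rewrite /edge1 /edge2 /edge3 /ang1 /ang2 /ang3 !vec3E.
have e (x y : R) : pi * (- x - - y) / 3 = pi * (y - x) / 3 by ring.
by rewrite !e; split; [split|]; ring.
Qed.

Lemma TC_vertex t : TC (vec3 n%:Z 0 (- n%:Z)) t = 3^-1 * (edgepow n' t)^*.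
Proof.
have ph (s : 'rV[R]_3) :
    phi (vec3 n%:Z 0 (- n%:Z)) s = (edge3 s ^+ n)^*.
  rewrite /edge3 -expiMn -expiN phiE !vec3E; congr expi.
  by rewrite intrN -[n%:Z%:~R]pmulrn /ang3; ring.
rewrite /TC PplusE; under eq_bigr do rewrite ph.
have [_ ->] := sum_images_edge (fun z => (z ^+ n)^*) t.
rewrite /edgepow -/n !rmorphD /=.
by move: (edge1 t ^+ n)^* (edge2 t ^+ n)^* (edge3 t ^+ n)^* => x y z; field.
Qed.

Lemma sum_images_edgepow t (u : 'rV[R]_3) :
  \sum_(s <- images t) edgepow n' (s - u) = 2 * edgepow n' t * (edgepow n' u)^*.
Proof.
rewrite /edgepow !rmorphD !rmorphXn /= -/n.
under eq_bigr do rewrite !edgeB !exprMn.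
move: ((edge1 u)^* ^+ n) ((edge2 u)^* ^+ n) ((edge3 u)^* ^+ n) => p q r.
transitivity ((\sum_(s <- images t) edge1 s ^+ n) * p
  + (\sum_(s <- images t) edge2 s ^+ n) * q
  + (\sum_(s <- images t) edge3 s ^+ n) * r).
  by rewrite !mulr_suml -!big_split.
have [[-> ->] ->] := sum_images_edge (fun z => z ^+ n) t.
by move: (edge1 t ^+ n) (edge2 t ^+ n) (edge3 t ^+ n) => x y z; ring.
Qed.

Lemma ellDelta_Theta (j : 'rV[int]_3) t : Lambda n j -> hplane t ->
  ellDelta n j t = (lambda n j)%:R / (3 * n%:R ^+ 2) *
    (2^-1 * Pplus (fun s => (Theta n%:Z (s - node R n j)
                             - Theta (n%:Z - 2) (s - node R n j))%:C) t
     - (complex.Re (TC (vec3 n%:Z 0 (- n%:Z)) t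
                    * (TC (vec3 n%:Z 0 (- n%:Z)) (node R n j))^*%C))%:C).
Proof.
move=> jL ht; set u := node R n j.
have uH : hplane u by apply: hplane_node; case: jL.
rewrite /ellDelta -mulrA; congr (_ * _); rewrite !PplusE /ell.
have eqs : {in images t, forall s, Phistar n (s - u) = (3 * n%:R ^+ 2)^-1 *
    (2^-1 * (Theta n%:Z (s - u) - Theta (n%:Z - 2) (s - u))%:C
     - 6^-1 * (edgepow n' (s - u) + (edgepow n' (s - u))^*))}.
  move=> s st; have sH := hplaneB (hplane_images ht st) uH.
  rewrite PhistarE -!Theta_cubesum // rmorphB /=.
  do ![congr (_ * _) | congr (_ - _)]; congr ((Theta _ _)%:C); rewrite /n; lia.
have c3 : (3^-1 : R[i])^* = 3^-1 
  by rewrite (fmorphV (@conjc R)) rmorph_nat.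
have cK (x : R[i]) : x^*^* = x by exact: conjcK.
have cR (x : R[i]) : (complex.Re x)%:C = (x + x^*) / 2 by exact: ReJ_add.
have cM (x y : R[i]) : (x * y)^* = x^* * y^* by exact: (rmorphM (@conjc R)).
have c2 : (2 : R[i])^* = 2 by exact: rmorph_nat.
have re : (complex.Re (TC (vec3 n%:Z 0 (- n%:Z)) t
                    * (TC (vec3 n%:Z 0 (- n%:Z)) u)^*%C))%:C
    = 18^-1 * ((edgepow n' t)^* * edgepow n' u
               + edgepow n' t * (edgepow n' u)^*).
  have tcu : (TC (vec3 n%:Z 0 (- n%:Z)) u)^*%C = 3^-1 * edgepow n' u.
    by rewrite TC_vertex; etransitivity; [exact: cM | rewrite c3 cK].
  rewrite cR tcu TC_vertex !cM !c3 !cK.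
  by move: (edgepow n' t) (edgepow n' u) => p q; field.
rewrite re (eq_big_seq _ eqs) -mulr_sumr mulrCA; congr (_ * _).
have conj_sum : \sum_(s <- images t) (edgepow n' (s - u))^*
    = (2 * edgepow n' t * (edgepow n' u)^*)^*.
  by rewrite -sum_images_edgepow [RHS](rmorph_sum (@conjc R)).
rewrite sumrB -!mulr_sumr big_split /= conj_sum sum_images_edgepow.
rewrite !cM !cK c2.
by move: (\sum_(s <- _) _) (edgepow n' t) (edgepow n' u) => *; field.
Qed.
End ClosedForm.

Theorem theorem4p7 (R : realType) (n : nat) (hn : (1 <= n)%N) :
  (forall f : 'rV[R]_3 -> R[i],
     {within @Delta R, continuous (f : 'rV[R]_3 -> R[i]^o)} ->
     [/\ TCspan n (Lstar n f),
         (forall j, Lambda n j -> Lstar n f (node R n j) = f (node R n j)) &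
         (forall g, TCspan n g ->
            (forall j, Lambda n j -> g (node R n j) = f (node R n j)) ->
            forall t : 'rV[R]_3, hplane t -> g t = Lstar n f t)]) /\
  (forall j, Lambda n j -> forall t : 'rV[R]_3, hplane t ->
     ellDelta n j t =
     (lambda n j)%:R / (3 * n%:R ^+ 2) *
     (2^-1 * Pplus (fun s => (Theta n%:Z (s - node R n j)
                              - Theta (n%:Z - 2) (s - node R n j))%:C) t
      - (complex.Re (TC (vec3 n%:Z 0 (- n%:Z)) t
                     * (TC (vec3 n%:Z 0 (- n%:Z)) (node R n j))^*%C))%:C)).
Proof.
case: n hn => // n' _; split=> [f _|j jL t ht]; last exact: ellDelta_Theta.
split; [exact: Lstar_span | exact: Lstar_node | exact: Lstar_unique].
Qed.
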